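(* Let $H$ be a real Hilbert space and let $T:H\to H$ be a nonexpansive operator (i.e. $\|Tu-Tv\|\le\|u-v\|$ for all $u,v\in H$) with $Fix(T)=\{x\in H: Tx=x\}\neq\varnothing$. Let $z^{0},z^{-1}\in H$, let $\{e^k\}_{k\ge0}$ be a sequence in $H$, let $\{\alpha_k\}_{k\ge0},\{\lambda_k\}_{k\ge0}$ be real sequences, and define for $k\ge 0$ $$\mu^{k}=z^{k}+\alpha_{k}(z^{k}-z^{k-1}),\qquad z^{k+1}=\mu^{k}+\lambda_{k}(T\mu^{k}+e^{k}-\mu^{k}).$$ Assume: (a) there are constants $\alpha\in[0,1)$ and $\lambda,\lambda'$ with $0<\lambda\le\lambda'<1$ such that $0\le\alpha_k\le\alpha$ and $\lambda\le\lambda_k\le\lambda'$ for all $k$; (b) $\sum_{k=0}^{+\infty}\alpha_k\|z^{k+1}-z^k\|^2<+\infty$ and $\sum_{k=0}^{+\infty}\lambda_k\|e^k\|<+\infty$; (c) the sequence $\{z^k\}$ is bounded. Then: (i) for every $z^*\in Fix(T)$, $\lim_{k\to+\infty}\|z^k-z^*\|$ exists; (ii) $\lim_{k\to+\infty}\|T\mu^k-\mu^k\|=0$; (iii) $\{z^k\}$ converges weakly to a fixed point of $T$. *)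

(* Defs.v *)
From HB Require Import structures.
From mathcomp Require Import all_boot all_order all_algebra.
From mathcomp Require Import all_classical all_reals all_analysis.
Set Implicit Arguments. Unset Strict Implicit. Unset Printing Implicit Defensive.
Import Order.TTheory GRing.Theory Num.Theory.
Import numFieldNormedType.Exports.
Local Open Scope ring_scope.
Local Open Scope classical_set_scope.

(* [ip] is an inner product on the real normed space [H] inducing its norm:
   symmetric, linear in the first argument, and ||x||^2 = <x,x>.
   Together with completeness of [H] this makes [H] a real Hilbert space. *)
Definition inner_product_of (R : realType) (H : normedModType R)
    (ip : H -> H -> R) : Prop :=
  [/\ (forall x y, ip x y = ip y x),
      (forall (a : R) x y w, ip (a *: x + y) w = a * ip x w + ip y w)
    & (forall x, `|x| ^+ 2 = ip x x)].

Definition weak_cvg (R : realType) (H : normedModType R)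
    (ip : H -> H -> R) (u : nat -> H) (x : H) : Prop :=
  forall y, (fun k => ip (u k) y) @ \oo --> ip x y.

Definition nonexpansive (R : realType) (H : normedModType R) (T : H -> H) :=
  forall u v, `|T u - T v| <= `|u - v|.

Definition zprev (T : Type) (zm1 : T) (z : nat -> T) (k : nat) : T :=
  if k is k'.+1 then z k' else zm1.

(* Main.v *)
(* With d_k = z_k - z_(k-1), the Fejer estimate needs sum alpha_k |d_k|^2, while
   the hypothesis bounds the shifted sum of alpha_k |d_(k+1)|^2. The gap is
   bridged by the residuals r_k = T z_k - z_k: |r_k|^2 almost decreases, by a
   multiple of |r_(k+1) - r_k|^2, and |d_(k+1)| is controlled by |d_(k+2)|,
   alpha_k |d_k|, |r_(k+1) - r_k| and the errors. This yields
     alpha_(k+1) |d_(k+1)|^2 <= alpha_k |d_k|^2 / 2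
                                + K (|r_k|^2 - |r_(k+1)|^2) + summable,
   and the unshifted sum is finite. The Fejer estimate then gives convergence of
   |z_k - x| for x in Fix(T) and T mu_k - mu_k -> 0. For weak convergence, the
   asymptotic center of (z_k) along any filter finer than the Frechet filter is
   a fixed point, hence the same one for all such filters, and minimality of
   this center along {k | <z_k - c, y> >= eps} is contradictory. *)
Require Import Defs.
From HB Require Import structures.
From mathcomp Require Import all_boot all_order all_algebra.
From mathcomp Require Import all_classical all_reals all_analysis.
From mathcomp Require Import ring lra.
Import Order.TTheory GRing.Theory Num.Theory.
Import numFieldNormedType.Exports.
Local Open Scope ring_scope.
Local Open Scope classical_set_scope.

(** * Inner product calculus *)

Lemma ip0l {R : realType} {H : normedModType R} {ip : H -> H -> R}
  (hip : inner_product_of ip) x : ip 0 x = 0.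
Proof.
case: hip => _ hl _; have := hl (-1) 0 0 x.
by rewrite scaler0 addr0 => *;lra.
Qed.

Lemma ipDl {R : realType} {H : normedModType R} {ip : H -> H -> R}
  (hip : inner_product_of ip) x y w : ip (x + y) w = ip x w + ip y w.
Proof. by case: hip => _ hl _; rewrite -{1}[x]scale1r hl mul1r. Qed.

Lemma ipZl {R : realType} {H : normedModType R} {ip : H -> H -> R}
  (hip : inner_product_of ip) c x w : ip (c *: x) w = c * ip x w.
Proof.
by rewrite -[c *: x]addr0; case: (hip) => _ -> _; rewrite (ip0l hip) addr0.
Qed.

Lemma ipNl {R : realType} {H : normedModType R} {ip : H -> H -> R}
  (hip : inner_product_of ip) x w : ip (- x) w = - ip x w.
Proof. by rewrite -scaleN1r (ipZl hip) mulN1r. Qed.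

Lemma ipDr {R : realType} {H : normedModType R} {ip : H -> H -> R}
  (hip : inner_product_of ip) x y w : ip w (x + y) = ip w x + ip w y.
Proof.
by case: (hip) => hs _ _; rewrite hs (ipDl hip) (hs x) (hs y).
Qed.

Lemma ipZr {R : realType} {H : normedModType R} {ip : H -> H -> R}
  (hip : inner_product_of ip) c x w : ip w (c *: x) = c * ip w x.
Proof. by case: (hip) => hs _ _; rewrite hs (ipZl hip) (hs x). Qed.

Lemma ipNr {R : realType} {H : normedModType R} {ip : H -> H -> R}
  (hip : inner_product_of ip) x w : ip w (- x) = - ip w x.
Proof. by rewrite -scaleN1r (ipZr hip) mulN1r. Qed.

Lemma ip_normDsqr {R : realType} {H : normedModType R} {ip : H -> H -> R}
  (hip : inner_product_of ip) x y :
  `|x + y| ^+ 2 = `|x| ^+ 2 + 2 * ip x y + `|y| ^+ 2.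
Proof.
case: (hip) => hs _ hn.
by rewrite !hn (ipDl hip) !(ipDr hip) (hs y x); ring.
Qed.

Lemma ip_normBsqr {R : realType} {H : normedModType R} {ip : H -> H -> R}
  (hip : inner_product_of ip) x y :
  `|x - y| ^+ 2 = `|x| ^+ 2 - 2 * ip x y + `|y| ^+ 2.
Proof. by rewrite (ip_normDsqr hip) (ipNr hip) normrN; ring. Qed.

Lemma ip_le_norm {R : realType} {H : normedModType R} {ip : H -> H -> R}
  (hip : inner_product_of ip) x y : ip x y <= `|x| * `|y|.
Proof.
have := ip_normDsqr hip x y.
have : `|x + y| ^+ 2 <= (`|x| + `|y|) ^+ 2.
  by rewrite lerXn2r ?nnegrE ?addr_ge0// ler_normD.
by rewrite sqrrD => *; lra.
Qed.

(** The weight [t] ranges over all reals: [1/2] gives midpoints, [lam] the relaxation step, and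
    [- al] the inertial extrapolation. *)
Lemma ip_norm_convex {R : realType} {H : normedModType R} {ip : H -> H -> R}
  (hip : inner_product_of ip) (t : R) (x y : H) :
  `|(1 - t) *: x + t *: y| ^+ 2 =
  (1 - t) * `|x| ^+ 2 + t * `|y| ^+ 2 - t * (1 - t) * `|x - y| ^+ 2.
Proof.
rewrite (ip_normDsqr hip) (ip_normBsqr hip) !normrZ !exprMn !real_normK ?num_real//.
by rewrite (ipZl hip) (ipZr hip); ring.
Qed.

(** * Series controlled through their partial sums *)

Definition sums_bounded {R : realType} (u : nat -> R) :=
  exists B, forall n, \sum_(0 <= k < n) u k <= B.

Lemma sums_bounded_cvg {R : realType} (u : nat -> R) (s : R) :
  (forall k, 0 <= u k) -> series u @ \oo --> s -> sums_bounded u.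
Proof.
move=> u0 us; exists s => n.
have -> : s = limn (series u) by apply/esym/cvg_lim.
apply: (nondecreasing_cvgn_le (u_ := series u)).
  by apply: nondecreasing_series => k _ _.
by apply/cvg_ex; exists s.
Qed.

Lemma sums_bounded_is_cvg {R : realType} (u : nat -> R) :
  (forall k, 0 <= u k) -> sums_bounded u -> cvgn (series u).
Proof.
move=> u0 [B uB]; apply: nondecreasing_is_cvgn.
  by apply: nondecreasing_series => k _ _.
by exists B => _ [n _ <-]; exact: uB.
Qed.

Lemma sums_bounded_cvg0 {R : realType} (u : nat -> R) :
  (forall k, 0 <= u k) -> sums_bounded u -> u @ \oo --> 0.
Proof. by move=> u0 uB; apply: cvg_series_cvg_0; exact: sums_bounded_is_cvg. Qed.

Lemma sums_boundedD {R : realType} (u v : nat -> R) :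
  sums_bounded u -> sums_bounded v -> sums_bounded (fun k => u k + v k).
Proof.
move=> [B uB] [C vC]; exists (B + C) => n.
by rewrite big_split lerD.
Qed.

Lemma sums_boundedZ {R : realType} (c : R) (u : nat -> R) :
  0 <= c -> sums_bounded u -> sums_bounded (fun k => c * u k).
Proof.
move=> c0 [B uB]; exists (c * B) => n.
by rewrite -mulr_sumr ler_wpM2l.
Qed.

Lemma sums_boundedS {R : realType} (u : nat -> R) :
  0 <= u 0%N -> sums_bounded u -> sums_bounded (fun k => u k.+1).
Proof.
move=> u0 [B uB]; exists B => n.
by have := uB n.+1; rewrite big_nat_recl// => *; lra.
Qed.

(** [V] is a potential: its decrements sum to [V 0 - V n], which is at most [V 0]. *)
Lemma sums_bounded_telescope {R : realType} (u V s : nat -> R) (c : R) :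
  0 < c -> (forall k, 0 <= V k) -> sums_bounded s ->
  (forall k, c * u k <= V k - V k.+1 + s k) -> sums_bounded u.
Proof.
move=> c0 V0 [B sB] h; exists (c^-1 * (V 0%N + B)) => n.
rewrite ler_pdivlMl// mulr_sumr.
have : \sum_(0 <= k < n) c * u k <= \sum_(0 <= k < n) (V k - V k.+1 + s k).
  by apply: ler_sum => k _.
rewrite big_split/= => /le_trans; apply; apply: lerD => //.
have -> : \sum_(0 <= k < n) (V k - V k.+1) = V 0%N - V n.
  by rewrite -[RHS]opprB -telescope_sumr// -sumrN; apply: eq_bigr => k _; rewrite opprB.
by have := V0 n => *; lra.
Qed.

(** Subtracting the partial sums of [p] from [u] leaves a nonincreasing sequence, bounded below
    since those sums are bounded above. *)
Lemma quasi_nonincreasing_cvg {R : realType} (u p : nat -> R) :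
  (forall k, 0 <= u k) -> (forall k, 0 <= p k) -> sums_bounded p ->
  (forall k, u k.+1 <= u k + p k) -> cvgn u.
Proof.
move=> u0 p0 pB h.
have cp := sums_bounded_is_cvg _ p0 pB.
have -> : u = (u \- series p) \+ series p.
  by apply/funext => k /=; rewrite subrK.
apply: is_cvgD => //; apply: nonincreasing_is_cvgn.
  apply/nonincreasing_seqP => k /=; rewrite seriesSr; have := h k => *; lra.
case: pB => B pB; exists (- B) => _ [n _ <-] /=.
by have := pB n; have := u0 n; rewrite /series/= => *; lra.
Qed.

(** * Asymptotic centers and weak convergence *)

(** Eventual bounds stand in for a limsup along [F]: [m] is the least limsup of the squared
    distances, reached at [c]. The second clause adds quadratic growth away from [c], hence
    uniqueness; the factor 1/2 is what a comparison with midpoints gives. *)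
Definition asymptotic_center {R : realType} {H : normedModType R}
    (F : set_system nat) (z : nat -> H) (c : H) (m : R) :=
  (forall eps, 0 < eps -> \forall k \near F, `|z k - c| ^+ 2 <= m + eps) /\
  (forall y b, (\forall k \near F, `|z k - y| ^+ 2 <= b) ->
     m + `|y - c| ^+ 2 / 2 <= b).

(** The midpoint estimate makes a minimizing sequence Cauchy, and its limit is [c]. The same
    estimate between [c] and a competitor gives the growth clause. *)
Lemma asymptotic_center_exists {R : realType} {H : completeNormedModType R}
  {ip : H -> H -> R} (hip : inner_product_of ip)
  (F : set_system nat) {FF : ProperFilter F} (z : nat -> H) (M : R) :
  (forall k, `|z k| <= M) -> exists c m, asymptotic_center F z c m.
Proof.
move=> hM.
pose P y b := \forall k \near F, `|z k - y| ^+ 2 <= b.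
pose S := [set b | exists y, P y b].
have lbS : lbound S 0.
  by move=> b [y /filter_ex[k]]; apply: le_trans; exact: sqr_ge0.
have infS : has_inf S.
  split; last by exists 0.
  exists (M ^+ 2); exists 0; apply: nearW => k.
  by rewrite subr0 lerXn2r ?nnegrE//; exact: le_trans (hM k).
set m := inf S.
have mS y b : P y b -> m <= b.
  by move=> Pyb; apply: ge_inf; [exists 0|exists y].
have m0 : 0 <= m by apply: lb_le_inf => //; case: infS.
(* Otherwise the midpoint of y and y' would beat the infimum m. *)
have mid y b y' b' : P y b -> P y' b' ->
    `|y - y'| ^+ 2 <= 2 * (b + b') - 4 * m.
  move=> hy hy'.
  have : m <= (b + b') / 2 - `|y - y'| ^+ 2 / 4.
    apply: (mS ((1 - 1/2) *: y + (1/2) *: y')).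
    apply: filterS2 hy hy' => k hy hy'.
    have -> : z k - ((1 - 1/2) *: y + (1/2) *: y') =
        (1 - 1/2) *: (z k - y) + (1/2) *: (z k - y').
      rewrite !scalerBr addrACA -scalerDl subrK scale1r opprD //.
    rewrite (ip_norm_convex hip).
    have -> : z k - y - (z k - y') = - (y - y').
      by rewrite !opprB addrC subrKA.
    by rewrite normrN; lra.
  by lra.
have /choice[y hy] : forall n, exists y, P y (m + harmonic n).
  move=> n; have [b [y hy] bm] := inf_adherent (harmonic_gt0 n) infS.
  by exists y; apply: filterS hy => k /le_trans; apply; exact: ltW.
have dy n p : `|y n - y p| ^+ 2 <= 2 * (harmonic n + harmonic p).
  by have := mid _ _ _ _ (hy n) (hy p); lra.
have h0 := @cvg_harmonic R.
have /cauchy_cvg/cvg_ex[c yc] : cauchy (y @ \oo).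
  apply: cauchy_exP => e e0.
  have e4 : 0 < e ^+ 2 / 4 by rewrite divr_gt0// exprn_gt0.
  have /cvgrPdist_lt/(_ _ e4)[N _ hN] := h0.
  have hh n : (N <= n)%N -> harmonic n < e ^+ 2 / 4.
    by move=> /hN/=; rewrite sub0r normrN ger0_norm ?harmonic_ge0.
  exists (y N); exists N => // n /= Nn.
  rewrite -ball_normE/= -(@ltr_pXn2r _ 2) ?nnegrE//; last exact: ltW.
  apply: le_lt_trans (dy _ _) _.
  by have := hh _ Nn; have := hh _ (leqnn N) => *; lra.
have Pc eps : 0 < eps -> P c (m + eps).
  move=> e0.
  have bc : (fun n => `|y n - c|) @ \oo --> 0.
    have : (fun n => y n - c) @ \oo --> c - c by apply: cvgB => //; exact: cvg_cst.
    by rewrite subrr => /cvg_norm; rewrite normr0.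
  (* Expanding [(|z k - y n| + |y n - c|) ^ 2] shows that this sequence bounds [|z k - c| ^ 2]
     eventually in [k]; [m + 2] bounds [|z k - y n|] because [2 * s <= s ^ 2 + 1]. *)
  have : (fun n => m + harmonic n + (2 * (m + 2) + `|y n - c|) * `|y n - c|)
      @ \oo --> m + 0 + (2 * (m + 2) + 0) * 0.
    apply: cvgD; first by apply: cvgD => //; exact: cvg_cst.
    by apply: cvgM => //; apply: cvgD => //; exact: cvg_cst.
  rewrite mulr0 !addr0 => /cvgrPdist_lt/(_ _ e0)[N _ /(_ N (leqnn N))/=].
  rewrite ltr_distlC => /andP[_ hN].
  apply: filterS (hy N) => k hk.
  apply: ltW; apply: le_lt_trans hN.
  have hh : harmonic N <= 1 :> R by rewrite /harmonic/= invf_le1// ler1n.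
  have : `|z k - c| ^+ 2 <= (`|z k - y N| + `|y N - c|) ^+ 2.
    by rewrite lerXn2r ?nnegrE ?addr_ge0// -[z k - c](subrKA (y N)) ler_normD.
  move=> /le_trans; apply.
  rewrite sqrrD.
  have q : `|z k - y N| <= m + 2.
    have := sqr_ge0 (`|z k - y N| - 1); rewrite sqrrB1 mulr2n => *.
    by have := normr_ge0 (z k - y N) => *; lra.
  have := ler_wpM2r (normr_ge0 (y N - c)) q.
  move: hk; rewrite /harmonic/=; set h := _^-1; move: h => h.
  by move: `|z k - y N| `|y N - c| => u v ? ?; lra.
exists c, m; split => // y' b hb.
have h eps : 0 < eps -> `|y' - c| ^+ 2 / 2 <= b - m + eps.
  by move=> /Pc /(mid _ _ _ _ hb) *; lra.
have : `|y' - c| ^+ 2 / 2 <= b - m by apply/ler_addgt0Pr => e /h.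
by lra.
Qed.

(** Since [|z k - T c| <= |T (z k) - z k| + |z k - c|], the point [T c] is asymptotically as close
    to the sequence as [c], and quadratic growth forces equality. *)
Lemma asymptotic_center_fixed {R : realType} {H : normedModType R}
  (T : H -> H) (hT : nonexpansive T)
  (F : set_system nat) {FF : ProperFilter F} (z : nat -> H) (M : R)
  (hM : forall k, `|z k| <= M)
  (hr : (fun k => `|T (z k) - z k|) @ F --> 0)
  (c : H) (m : R) : asymptotic_center F z c m -> T c = c.
Proof.
move=> [hc hm].
have h eps : 0 < eps -> `|T c - c| ^+ 2 / 2 <= 2 * eps.
  move=> e0; suff /hm : \forall k \near F, `|z k - T c| ^+ 2 <= m + 2 * eps by lra.
  have : (fun k => (2 * (M + `|c|) + `|T (z k) - z k|) * `|T (z k) - z k|) @ F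
      --> (2 * (M + `|c|) + 0) * 0.
    by apply: cvgM => //; apply: cvgD => //; exact: cvg_cst.
  rewrite mulr0 => /cvgrPdist_lt/(_ _ e0); apply: filterS2 (hc _ e0) => k hk.
  rewrite ltr_distlC => /andP[_ hN].
  have : `|z k - T c| ^+ 2 <= (`|T (z k) - z k| + `|z k - c|) ^+ 2.
    rewrite lerXn2r ?nnegrE ?addr_ge0// -[z k - T c](subrKA (T (z k))).
    by rewrite (le_trans (ler_normD _ _))// lerD// distrC.
  move=> /le_trans; apply; rewrite sqrrD.
  have q : `|z k - c| <= M + `|c|.
    by rewrite (le_trans (ler_normB _ _))// lerD.
  have := ler_wpM2r (normr_ge0 (T (z k) - z k)) q => *.
  by lra.
have : `|T c - c| ^+ 2 <= 0.
  by apply/ler_addgt0Pr => e e0; have := h (e / 4) => *; lra.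
by rewrite real_exprn_even_le0 ?num_real//= normr_eq0 subr_eq0 => /eqP.
Qed.

(** Used in both directions between two centers: if the distances to each have full limits, the two
    inequalities add up to equality of the centers. *)
Lemma asymptotic_center_lim {R : realType} {H : normedModType R}
  (F : set_system nat) {FF : ProperFilter F} (z : nat -> H)
  (c : H) (m : R) (y : H) (L L' : R) : asymptotic_center F z c m ->
  (fun k => `|z k - c|) @ F --> L -> (fun k => `|z k - y|) @ F --> L' ->
  L ^+ 2 + `|y - c| ^+ 2 / 2 <= L' ^+ 2.
Proof.
move=> [hc hm] hL hL'.
have h eps : 0 < eps -> L ^+ 2 + `|y - c| ^+ 2 / 2 <= L' ^+ 2 + 3 * eps.
  move=> e0.
  have /cvgrPdist_lt/(_ _ e0) c2 : (fun k => `|z k - c| ^+ 2) @ F --> L ^+ 2.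
    by under eq_fun do rewrite expr2; rewrite expr2; exact: cvgM.
  have /cvgrPdist_lt/(_ _ e0) y2 : (fun k => `|z k - y| ^+ 2) @ F --> L' ^+ 2.
    by under eq_fun do rewrite expr2; rewrite expr2; exact: cvgM.
  have /hm hy : \forall k \near F, `|z k - y| ^+ 2 <= L' ^+ 2 + eps.
    by apply: filterS y2 => k; rewrite ltr_distlC => /andP[_ /ltW].
  have [k []] := filter_ex (filterI c2 (hc _ e0)).
  by rewrite /= ltr_distlC => /andP[? _] ?; lra.
by apply/ler_addgt0Pr => e e0; have := h (e / 3) => *; lra.
Qed.

Lemma weak_cvg_fixed_point {R : realType} {H : completeNormedModType R}
  {ip : H -> H -> R} (hip : inner_product_of ip)
  {T : H -> H} (hT : nonexpansive T) {z : nat -> H} {M : R}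
  (hM : forall k, `|z k| <= M)
  (hr : (fun k => `|T (z k) - z k|) @ \oo --> 0)
  (hL : forall x, T x = x -> exists L : R, (fun k => `|z k - x|) @ \oo --> L) :
  exists x, T x = x /\ weak_cvg ip z x.
Proof.
have [c [m cm]] := asymptotic_center_exists hip \oo z M hM.
have Tc : T c = c by exact: (asymptotic_center_fixed T hT \oo z M hM hr c m cm).
exists c; split => //.
have [L cL] := hL c Tc.
have half (y : H) (eps : R) : 0 < eps -> \forall k \near \oo, ip (z k - c) y < eps.
  move=> e0; pose S := [set k | eps <= ip (z k - c) y].
  have [//|nS] := pselect (\forall k \near \oo, ip (z k - c) y < eps).
  (* If the bound fails to hold eventually, [S] meets every tail, which is properness. *)
  have PF : ProperFilter (within S \oo).
    apply: Build_ProperFilter_ex => P hP.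
    apply: contrapT => nP; apply: nS.
    have hP' : \forall k \near \oo, S k -> P k := hP.
    apply: filterS hP' => k {}hP.
    rewrite ltNge; apply/negP => Sk; apply: nP; exists k.
    exact: hP.
  have sub : \oo `<=` within S \oo by move=> A; apply: filterS => k.
  have subc (u : nat -> R) l : u @ \oo --> l -> u @ within S \oo --> l.
    by move=> ul A /ul; exact: sub.
  have [c' [m' cm']] := asymptotic_center_exists hip (within S \oo) z M hM.
  have Tc' : T c' = c'.
    by apply: (asymptotic_center_fixed T hT _ z M hM _ c' m' cm'); exact: subc.
  have [L' cL'] := hL c' Tc'.
  have E : c = c'.
    have h1 : L ^+ 2 + `|c' - c| ^+ 2 / 2 <= L' ^+ 2.
      exact: (asymptotic_center_lim _ _ _ _ _ _ _ cm cL cL').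
    have h2 : L' ^+ 2 + `|c - c'| ^+ 2 / 2 <= L ^+ 2.
      by apply: (asymptotic_center_lim (within S \oo) z c' m' c L' L cm'); exact: subc.
    have : `|c - c'| ^+ 2 <= 0 by move: h1; rewrite distrC => h1; lra.
    by rewrite real_exprn_even_le0 ?num_real//= normr_eq0 subr_eq0 => /eqP.
  exfalso; move: cm' => {cL' Tc'}; rewrite -E => -[hc hm].
  pose N : R := `|y| ^+ 2; have N0 : 0 <= N by exact: sqr_ge0.
  (* On [S], moving the center by [t *: y] lowers the squared distance by at least
     [2 * t * eps - t ^ 2 * N]. With this [t] the gain is [t ^ 2 * (N + 2) > 0], against minimality;
     the [+ 1] covers [y = 0]. *)
  pose t : R := eps / (N + 1).
  have N1 : 0 < N + 1 by rewrite ltr_wpDl.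
  have tN : t * (N + 1) = eps by rewrite /t divfK// gt_eqF.
  have t0 : 0 < t by rewrite divr_gt0.
  have h (d : R) : 0 < d -> 2 * t * eps <= t ^+ 2 * N + d.
    move=> d0.
    suff /hm : \forall k \near within S \oo,
        `|z k - (c + t *: y)| ^+ 2 <= m' + d - 2 * t * eps + t ^+ 2 * N.
      by have := sqr_ge0 `|c + t *: y - c| => *; lra.
    have SS : within S \oo S by apply: nearW.
    apply: filterS2 SS (hc _ d0) => k Sk hk.
    rewrite opprD addrA (ip_normBsqr hip) (ipZr hip) normrZ exprMn.
    rewrite real_normK ?num_real//.
    by have := ler_wpM2l (ltW t0) Sk => *; rewrite /N; lra.
  have : 2 * t * eps <= t ^+ 2 * N by apply/ler_addgt0Pr.
  rewrite -tN => ?; have : 0 < t ^+ 2 * (N + 2); last by nra.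
  by rewrite mulr_gt0 ?exprn_gt0//; lra.
move=> y; apply/cvgrPdist_lt => eps e0.
apply: filterS2 (half y _ e0) (half (- y) _ e0) => k.
rewrite (ipNr hip) (ipDl hip) (ipNl hip) ltr_norml => *.
by apply/andP; split; lra.
Qed.

(** * One-step estimates for the inertial iteration *)

(** Turns vector identities into scalar ones within reach of [ring] and [field]. *)
Lemma ip_ext {R : realType} {H : normedModType R} {ip : H -> H -> R}
  (hip : inner_product_of ip) (x y : H) : (forall w, ip x w = ip y w) -> x = y.
Proof.
move=> h; apply/eqP; rewrite -subr_eq0 -normr_eq0 -sqrf_eq0.
case: (hip) => _ _ ->.
by rewrite (ipDl hip) (ipNl hip) h subrr.
Qed.

Lemma nonexpansive_residual_le {R : realType} {H : normedModType R}
  {T : H -> H} (hT : nonexpansive T) (x y : H) :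
  `|(T x - x) - (T y - y)| <= 2 * `|x - y|.
Proof.
have -> : (T x - x) - (T y - y) = (T x - T y) - (x - y).
  by rewrite !opprB addrACA [RHS]addrACA; congr (_ + _); rewrite addrC.
by have := ler_normB (T x - T y) (x - y); have := hT x y => ? ?; lra.
Qed.

(** As [T zn - T z = Dr + D], nonexpansiveness reads [|Dr| ^ 2 + 2 * ip Dr D <= 0]. Substituting
    [D = lam *: r + w], with [w] collecting inertia and error, controls the cross term in the
    expansion of [|r + Dr| ^ 2]. *)
Lemma residual_decrease {R : realType} {H : normedModType R}
  {ip : H -> H -> R} (hip : inner_product_of ip)
  {T : H -> H} (hT : nonexpansive T) (al lam l l' : R) (z d e zn : H) :
  0 <= al -> 0 < l -> l <= lam <= l' -> l' < 1 ->
  zn = z + al *: d + lam *: (T (z + al *: d) + e - (z + al *: d)) ->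
  (1 - l') * `|(T zn - zn) - (T z - z)| ^+ 2 <=
  `|T z - z| ^+ 2 - `|T zn - zn| ^+ 2
  + 4 / l * `|zn - z| * (3 * (al * `|d|) + `|e|).
Proof.
move=> al0 l0 /andP[llam laml'] l'1 E.
set mu := z + al *: d in E.
set D := zn - z; set r := T z - z; set Dr := T zn - zn - r.
set v := (T mu - mu) - r.
pose w := al *: d + lam *: (v + e).
have lam0 : 0 < lam by exact: lt_le_trans llam.
have Dw : D = lam *: r + w.
  rewrite /D E /w /v /mu; apply: (ip_ext hip) => x.
  by rewrite !(ipDl hip, ipNl hip, ipZl hip); ring.
have hv : `|v| <= 2 * (al * `|d|).
  have := nonexpansive_residual_le hT mu z.
  have -> : mu - z = al *: d by rewrite /mu addrAC subrr add0r.
  by rewrite normrZ (ger0_norm al0).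
have hw : `|w| <= 3 * (al * `|d|) + `|e|.
  have : `|w| <= al * `|d| + lam * (`|v| + `|e|).
    rewrite (le_trans (ler_normD _ _))// !normrZ (ger0_norm al0) gtr0_norm//.
    by rewrite lerD2l ler_wpM2l ?ler_normD// ltW.
  have := ler_wpM2r (addr_ge0 (normr_ge0 v) (normr_ge0 e)) (le_trans laml' (ltW l'1)).
  move: hv; move: `|w| `|v| (al * `|d|) `|e| => *; lra.
have hDr : `|Dr| <= 2 * `|D| by exact: nonexpansive_residual_le.
have h1 : `|Dr| ^+ 2 + 2 * ip Dr D <= 0.
  have : `|Dr + D| ^+ 2 <= `|D| ^+ 2.
    rewrite lerXn2r ?nnegrE//; apply: le_trans (hT zn z).
    rewrite /Dr /D /r le_eqVlt; apply/orP; left; apply/eqP; congr `|_|.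
    apply: (ip_ext hip) => x.
    by rewrite !(ipDl hip, ipNl hip); ring.
  by rewrite (ip_normDsqr hip) => *; lra.
have h2 : `|T zn - zn| ^+ 2 = `|r| ^+ 2 + 2 * ip Dr r + `|Dr| ^+ 2.
  rewrite -[T zn - zn](subrK r) -/Dr (ip_normDsqr hip); ring.
have h3 : - ip Dr w <= `|Dr| * `|w|.
  by rewrite -(ipNl hip) -[`|Dr|]normrN; exact: ip_le_norm.
rewrite h2; move: h1; rewrite Dw (ipDr hip) (ipZr hip) -Dw => h1.
have W0 : 0 <= `|w| by [].
have D0 : 0 <= `|D| by [].
have h4 : `|Dr| * `|w| <= 2 * (`|D| * (3 * (al * `|d|) + `|e|)).
  rewrite mulrA; apply: ler_pM => //.
move: (3 * (al * `|d|) + `|e|) h4 hw => W h4 hw.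
have {}h4 : lam * (2 * ip Dr r + `|Dr| ^+ 2) <=
    - ((1 - lam) * `|Dr| ^+ 2) + 4 * (`|D| * W) by lra.
have DW : 0 <= `|D| * W by rewrite mulr_ge0//; exact: le_trans hw.
have p0 := sqr_ge0 `|Dr|.
(* The estimate [h4] carries a factor [lam], so the goal is multiplied by it; [1 / l] dominates
   [1 / lam]. *)
rewrite -(ler_pM2l lam0).
have li : lam * (`|D| * W) / l >= `|D| * W.
  by rewrite mulrAC ler_peMl// ler_pdivlMr// mul1r.
have lp : lam * ((1 - l') * `|Dr| ^+ 2) <= (1 - lam) * `|Dr| ^+ 2.
  apply: (@le_trans _ _ ((1 - l') * `|Dr| ^+ 2)).
    by rewrite ler_piMl// ?mulr_ge0//; lra.
  by rewrite ler_wpM2r//; lra.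
move: li lp h4; move: (`|Dr| ^+ 2) (ip Dr r) l^-1 => p s i.
by move=> *; lra.
Qed.

(** Each step equation gives the residual at the extrapolated point as increment over relaxation
    parameter. Comparing two consecutive ones through the residuals at [z] and [zn] isolates a
    multiple of [zn - z]. *)
Lemma increment_le {R : realType} {H : normedModType R}
  {ip : H -> H -> R} (hip : inner_product_of ip)
  {T : H -> H} (hT : nonexpansive T) (a al al' lam lam' l : R)
  (z d e e' zn znn : H) :
  0 <= al -> 0 <= al' <= a -> 0 < l -> l <= lam < 1 -> l <= lam' < 1 ->
  zn = z + al *: d + lam *: (T (z + al *: d) + e - (z + al *: d)) ->
  znn = zn + al' *: (zn - z)
        + lam' *: (T (zn + al' *: (zn - z)) + e' - (zn + al' *: (zn - z))) ->
  (1 - a) * `|zn - z| <= `|znn - zn| / l + (1 / l + 2) * (al * `|d|)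
    + `|(T zn - zn) - (T z - z)| + (`|e| + `|e'|).
Proof.
move=> al0 /andP[al'0 al'a] l0 /andP[llam lam1] /andP[llam' lam'1] E E'.
set mu := z + al *: d in E; set mu' := zn + al' *: (zn - z) in E'.
have lam0 : 0 < lam by exact: lt_le_trans llam.
have lam'0 : 0 < lam' by exact: lt_le_trans llam'.
set D := zn - z.
set Dr := _ - _ - (T z - z).
pose v := (T mu - mu) - (T z - z).
(* The term [T mu' - T zn] costs a further [al' * |D|]; what remains is
   [t - al' >= 1 - al' >= 1 - a]. *)
pose t := lam^-1 + al' / lam' - al'.
have V : t *: D = lam'^-1 *: (znn - zn) + (al / lam) *: d - Dr + v - e' + e
    - (T mu' - T zn).
  apply: (ip_ext hip) => x.
  have Tmu : ip (T mu) x = (ip zn x - ip z x - al * ip d x) / lam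
      - ip e x + ip z x + al * ip d x.
    have := congr1 (ip ^~ x) E; rewrite /= !(ipDl hip, ipNl hip, ipZl hip) => ->.
    by field; rewrite gt_eqF.
  rewrite /v /Dr /D E' {2}/mu'.
  rewrite !(ipDl hip, ipNl hip, ipZl hip) Tmu /t.
  move: (ip (T zn) x) (ip (T mu') x) => ? ?.
  by field; rewrite !gt_eqF.
have hq : `|T mu' - T zn| <= al' * `|D|.
  apply: le_trans (hT _ _) _.
  by rewrite /mu' addrAC subrr add0r normrZ (ger0_norm al'0).
have hv : `|v| <= 2 * (al * `|d|).
  have := nonexpansive_residual_le hT mu z.
  have -> : mu - z = al *: d by rewrite /mu addrAC subrr add0r.
  by rewrite normrZ (ger0_norm al0).
have i1 : lam^-1 >= 1 by rewrite invf_ge1// ltW.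
have i1' : al' / lam' >= al' by rewrite ler_peMr// invf_ge1// ltW.
have il : lam^-1 <= l^-1 by rewrite lef_pV2 ?posrE.
have il' : lam'^-1 <= l^-1 by rewrite lef_pV2 ?posrE.
have t0 : 0 <= t by rewrite /t; lra.
have : `|t *: D| <= lam'^-1 * `|znn - zn| + (al / lam) * `|d| + `|Dr| + `|v|
    + `|e'| + `|e| + `|T mu' - T zn|.
  rewrite V.
  do 6! (apply: le_trans (ler_normB _ _) _ || apply: le_trans (ler_normD _ _) _; rewrite ?lerD2r).
  rewrite !normrZ !ger0_norm ?invr_ge0 ?mulr_ge0 ?invr_ge0//; exact: ltW.
rewrite normrZ (ger0_norm t0) => hV.
have tD : (1 - a) * `|D| <= (t - al') * `|D|.
  by rewrite ler_wpM2r// /t; lra.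
have b1 := ler_wpM2r (normr_ge0 (znn - zn)) il'.
have b2 := ler_wpM2r (mulr_ge0 al0 (normr_ge0 d)) il.
move: tD hV hv hq b1 b2.
move: `|D| `|Dr| `|v| `|e| `|e'| `|znn - zn| `|d| `|T mu' - T zn| lam^-1 lam'^-1 l^-1.
by move=> *; lra.
Qed.

(** Without its error, [zn - x] is a convex combination of [mu - x] and [T mu - x], while [mu - x]
    is an affine combination of [z - x] and [zp - x] with weight [- al]. The factor 2 comes from
    [al ^ 2 <= al]. *)
Lemma fejer_inertial {R : realType} {H : normedModType R}
  {ip : H -> H -> R} (hip : inner_product_of ip)
  {T : H -> H} (hT : nonexpansive T) (al lam : R) (z zp e zn mu x : H) :
  T x = x -> 0 <= al <= 1 -> 0 <= lam <= 1 ->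
  mu = z + al *: (z - zp) -> zn = mu + lam *: (T mu + e - mu) ->
  `|zn - x| ^+ 2 <= `|z - x| ^+ 2 + al * (`|z - x| ^+ 2 - `|zp - x| ^+ 2)
    + 2 * (al * `|z - zp| ^+ 2) - lam * (1 - lam) * `|T mu - mu| ^+ 2
    + 2 * `|zn - x| * (lam * `|e|).
Proof.
move=> Tx /andP[al0 al1] /andP[lam0 lam1] Emu E.
pose u := zn - x - lam *: e.
have hu : `|u| ^+ 2 <= `|mu - x| ^+ 2 - lam * (1 - lam) * `|T mu - mu| ^+ 2.
  have -> : u = (1 - lam) *: (mu - x) + lam *: (T mu - x).
    apply: (ip_ext hip) => w; rewrite /u E.
    by rewrite !(ipDl hip, ipNl hip, ipZl hip); ring.
  rewrite (ip_norm_convex hip).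
  have -> : `|mu - x - (T mu - x)| = `|T mu - mu|.
    by rewrite distrC; congr `|_|; rewrite opprB addrA subrK.
  have : `|T mu - x| ^+ 2 <= `|mu - x| ^+ 2.
    by rewrite lerXn2r ?nnegrE// -{1}Tx; exact: hT.
  by move=> /(ler_wpM2l lam0) h; lra.
have hmu : `|mu - x| ^+ 2 = (1 + al) * `|z - x| ^+ 2 - al * `|zp - x| ^+ 2
    + al * (1 + al) * `|z - zp| ^+ 2.
  have -> : mu - x = (1 - (- al)) *: (z - x) + (- al) *: (zp - x).
    apply: (ip_ext hip) => w; rewrite Emu.
    by rewrite !(ipDl hip, ipNl hip, ipZl hip); ring.
  rewrite (ip_norm_convex hip).
  have -> : z - x - (zp - x) = z - zp by rewrite opprB addrA subrK.
  by ring.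
have lb : `|zn - x| ^+ 2 - 2 * `|zn - x| * (lam * `|e|) <= `|u| ^+ 2.
  rewrite /u (ip_normBsqr hip (zn - x)) (ipZr hip).
  have := ler_wpM2l lam0 (ip_le_norm hip (zn - x) e) => ?.
  by have := sqr_ge0 `|lam *: e| => ?; lra.
have : al * al * `|z - zp| ^+ 2 <= al * `|z - zp| ^+ 2.
  by rewrite -mulrA ler_piMl// mulr_ge0// sqr_ge0.
move: hu hmu lb; move: (`|u| ^+ 2) (`|mu - x| ^+ 2) => *; lra.
Qed.

(* Here x, y, w stand for three consecutive increments |d_k|, |d_(k+1)|,
   |d_(k+2)|, p for |r_(k+1) - r_k|, f and f' for error norms, and g for
   |r_k|^2 - |r_(k+1)|^2, where r_k = T z_k - z_k. The two premises relating
   them are increment_le and residual_decrease. If al is bounded away from 0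
   then y^2 is controlled by al * y^2; if al is small then the al^2 x^2 coming
   from the squared first premise is absorbed in al x^2 / 4. *)
Lemma inertial_energy_bound {R : realType} (a l c D : R) :
  0 <= a < 1 -> 0 < l -> 0 < c -> 0 <= D ->
  exists K C, [/\ 0 <= K, 0 <= C & forall x y w p f f' g al al' : R,
    0 <= x -> 0 <= y <= D -> 0 <= w -> 0 <= p -> 0 <= f -> 0 <= f' ->
    0 <= al <= a -> 0 <= al' <= a ->
    (1 - a) * y <= w / l + (1 / l + 2) * (al * x) + p + (f + f') ->
    c * p ^+ 2 <= g + 4 / l * y * (3 * (al * x) + f) ->
    al' * y ^+ 2 <= K * g + 1 / 2 * (al * x ^+ 2)
      + C * (al * y ^+ 2 + al' * w ^+ 2 + (f + f'))].
Proof.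
move=> /andP[a0 a1] l0 c0 D0.
pose b := 1 - a; have b0 : 0 < b by rewrite subr_gt0.
pose i := (b ^+ 2)^-1; have i0 : 0 < i by rewrite invr_gt0 exprn_gt0.
pose j := l^-1; have j0 : 0 < j by rewrite invr_gt0.
pose q := j + 2; have q0 : 0 < q by rewrite /q; lra.
(* Chosen so that [K] times the second premise cancels the [3 * i * p ^ 2] left by the first; [k] is
   then the coefficient of [y * (al * x)]. *)
pose K := 3 * i / c; have K0 : 0 < K by rewrite divr_gt0// mulr_gt0.
pose k := 12 * K * j; have k0 : 0 < k by rewrite mulr_gt0// mulr_gt0.
pose C1 := 3 * i * j ^+ 2; pose C2 := 3 * i * q ^+ 2; pose C4 := 2 * i * b * D.
pose C5 := 4 * K * j * D.
have C10 : 0 < C1 by rewrite mulr_gt0 ?exprn_gt0// mulr_gt0.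
have C20 : 0 < C2 by rewrite mulr_gt0 ?exprn_gt0// mulr_gt0.
have C40 : 0 <= C4 by rewrite mulr_ge0// mulr_ge0 ?ltW// mulr_gt0.
have C50 : 0 <= C5 by rewrite mulr_ge0// mulr_ge0 ?ltW// mulr_gt0.
have k20 : 0 < k ^+ 2 by rewrite exprn_gt0.
exists K, (k ^+ 2 + 4 * C2 + C1 + C4 + C5); split; [exact: ltW|lra|].
move=> x y w p f f' g al al' x0 /andP[y0 yD] w0 p0 f0 f'0 /andP[al0 ala]
  /andP[al'0 al'a] hG hL.
have sq (t : R) : 0 <= t ^+ 2 by exact: sqr_ge0.
have cross : k * (y * (al * x)) <= 1 / 4 * (al * x ^+ 2) + k ^+ 2 * (al * y ^+ 2).
  by have := mulr_ge0 al0 (sq (x / 2 - k * y)); lra.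
have hg : 0 <= K * g - 3 * i * p ^+ 2 + 1 / 4 * (al * x ^+ 2)
    + k ^+ 2 * (al * y ^+ 2) + C5 * f.
  have Kc : K * c = 3 * i by rewrite /K divfK// gt_eqF.
  have := ler_wpM2l (ltW K0) hL; rewrite [K * (c * _)]mulrA Kc -/j => h.
  have yf : y * f <= D * f by rewrite ler_wpM2r.
  have := ler_wpM2l (ltW (mulr_gt0 (mulr_gt0 (ltr0n R 4) K0) j0)) yf => h'.
  by move: cross h h'; rewrite /k /C5; lra.
have hf : 0 <= f + f' by lra.
have S0 : 0 <= al * y ^+ 2 by rewrite mulr_ge0.
have S1 : 0 <= al' * w ^+ 2 by rewrite mulr_ge0.
have X0 : 0 <= al * x ^+ 2 by rewrite mulr_ge0.
have split_C : k ^+ 2 * (al * y ^+ 2) + 4 * C2 * (al * y ^+ 2)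
    + C1 * (al' * w ^+ 2) + C4 * (f + f') + C5 * f <=
  (k ^+ 2 + 4 * C2 + C1 + C4 + C5) * (al * y ^+ 2 + al' * w ^+ 2 + (f + f')).
  have m1 := mulr_ge0 (ltW k20) (addr_ge0 S1 hf).
  have m2 := mulr_ge0 (ltW C20) (addr_ge0 S1 hf).
  have m3 := mulr_ge0 (ltW C10) (addr_ge0 S0 hf).
  have m4 := mulr_ge0 C40 (addr_ge0 S0 S1).
  have m5 := mulr_ge0 C50 (addr_ge0 (addr_ge0 S0 S1) f'0).
  by move: (k ^+ 2) (al * y ^+ 2) (al' * w ^+ 2) m1 m2 m3 m4 m5 => *; lra.
have al'1 : al' <= 1 by lra.
(* Below this threshold [C2 * al ^ 2 * x ^ 2] is at most a quarter of [al * x ^ 2]; the other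
   quarter allowed went into [cross]. *)
have [small|large] := leP (4 * C2 * al) 1; last first.
  have : al' * y ^+ 2 <= y ^+ 2 by rewrite ler_piMl.
  have : y ^+ 2 <= 4 * C2 * (al * y ^+ 2) by rewrite mulrA ler_peMl// ltW.
  have : 0 <= 3 * i * p ^+ 2 by rewrite !mulr_ge0// ltW.
  have := mulr_ge0 (ltW C10) S1; have := mulr_ge0 C40 hf.
  by move: hg split_C; lra.
have hy : b ^+ 2 * y ^+ 2 <=
    3 * (j ^+ 2 * w ^+ 2 + q ^+ 2 * (al * x) ^+ 2 + p ^+ 2) + 2 * (b * D * (f + f')).
  (* The first premise is multiplied by [b * y] rather than squared, so that [f + f'] enters
     linearly, through [y <= D]. *)
  have young (t : R) : b * y * t <= (b * y) ^+ 2 / 6 + 3 / 2 * t ^+ 2.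
    by have := sq (b * y - 3 * t); lra.
  have by0 : 0 <= b * y by rewrite mulr_ge0// ltW.
  have := ler_wpM2l by0 hG.
  have := young (w * j); have := young (q * (al * x)); have := young p.
  have : b * y * (f + f') <= b * D * (f + f').
    by rewrite ler_wpM2r// ler_wpM2l// ltW.
  by rewrite div1r -/j -/q -/b; lra.
have bi : i * b ^+ 2 = 1 by rewrite mulVf// gt_eqF// exprn_gt0.
have := ler_wpM2l (ltW i0) hy; rewrite [i * (b ^+ 2 * _)]mulrA bi mul1r => {}hy.
have := ler_wpM2l al'0 hy.
have h1 : al' * (C2 * (al * (al * x ^+ 2))) <= 1 / 4 * (al * x ^+ 2).
  have h : C2 * (al * (al * x ^+ 2)) <= 1 / 4 * (al * x ^+ 2).
    by have := ler_wpM2r X0 small; lra.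
  by apply: le_trans h; rewrite ler_piMl// !mulr_ge0// ltW.
have h2 : al' * (3 * i * p ^+ 2) <= 3 * i * p ^+ 2.
  by rewrite ler_piMl// !mulr_ge0// ltW.
have h3 : al' * (C4 * (f + f')) <= C4 * (f + f').
  by rewrite ler_piMl// mulr_ge0.
have h4 : 0 <= 4 * C2 * (al * y ^+ 2) by rewrite !mulr_ge0// ltW.
by move: hg split_C h1 h2 h3 h4; rewrite /C1 /C2 /C4; lra.
Qed.


(** * Convergence of the iteration *)

Lemma cvg_norm_sqrt {R : realType} (u : nat -> R) (L : R) :
  (fun k => `|u k| ^+ 2) @ \oo --> L -> (fun k => `|u k|) @ \oo --> Num.sqrt L.
Proof.
move=> h; have -> : (fun k => `|u k|) = (fun k => Num.sqrt (`|u k| ^+ 2)).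
  by apply/funext => k; rewrite sqrtr_sqr normr_id.
by apply: continuous_cvg => //; exact: sqrt_continuous.
Qed.

Theorem theorem1 (R : realType) (H : completeNormedModType R)
  (ip : H -> H -> R) (hip : inner_product_of ip)
  (T : H -> H) (hT : nonexpansive T) (hFix : exists x, T x = x)
  (zm1 : H) (z mu : nat -> H) (e : nat -> H) (alpha lambda : nat -> R)
  (hmu : forall k, mu k = z k + alpha k *: (z k - zprev zm1 z k))
  (hz : forall k, z k.+1 = mu k + lambda k *: (T (mu k) + e k - mu k))
  (a l l' : R) (ha : 0 <= a < 1) (hl : 0 < l) (hll : l <= l') (hl' : l' < 1)
  (halpha : forall k, 0 <= alpha k <= a)
  (hlambda : forall k, l <= lambda k <= l')
  (hsum1 : exists s : R,
     series (fun k => alpha k * `|z k.+1 - z k| ^+ 2) @ \oo --> s)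
  (hsum2 : exists s : R, series (fun k => lambda k * `|e k|) @ \oo --> s)
  (hbdd : exists M : R, forall k, `|z k| <= M) :
  (forall zs, T zs = zs -> exists L : R, (fun k => `|z k - zs|) @ \oo --> L)
  /\ (fun k => `|T (mu k) - mu k|) @ \oo --> (0 : R)
  /\ (exists x, T x = x /\ weak_cvg ip z x).
Proof.
have [M hM] := hbdd.
have /andP[a0 a1] := ha.
have M0 : 0 <= M by exact: le_trans (hM 0%N).
have al0 k : 0 <= alpha k by have /andP[] := halpha k.
have ala k : alpha k <= a by have /andP[] := halpha k.
have ll k : l <= lambda k by have /andP[] := hlambda k.
have ll' k : lambda k <= l' by have /andP[] := hlambda k.
have lam0 k : 0 < lambda k by exact: lt_le_trans (ll k).
have lam1 k : lambda k < 1 by exact: le_lt_trans (ll' k) _.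
(* [d k.+1] reduces to [z k.+1 - z k], so [hsum1] speaks of [alpha k * |d k.+1| ^ 2]. *)
pose d k := z k - zprev zm1 z k.
have zE k : z k.+1 = z k + alpha k *: d k
    + lambda k *: (T (z k + alpha k *: d k) + e k - (z k + alpha k *: d k)).
  by rewrite hz hmu.
have hsl : sums_bounded (fun k => lambda k * `|e k|).
  have [s hs] := hsum2; apply: sums_bounded_cvg hs => k.
  by rewrite mulr_ge0// ltW.
have he : sums_bounded (fun k => `|e k|).
  apply: (sums_bounded_telescope _ (fun=> 0) _ _ hl _ hsl) => // k.
  by rewrite subrr add0r ler_wpM2r.
have hs1 : sums_bounded (fun k => alpha k * `|d k.+1| ^+ 2).
  have [s hs] := hsum1; apply: sums_bounded_cvg hs => k.
  by rewrite mulr_ge0// sqr_ge0.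
have dD k : `|d k.+1| <= 2 * M.
  rewrite (le_trans (ler_normB _ _))//.
  by have := hM k.+1; have := hM k => ? ?; lra.
pose A k := alpha k * `|d k| ^+ 2.
have A0 k : 0 <= A k by rewrite mulr_ge0// sqr_ge0.
have hA : sums_bounded A.
  have c0 : 0 < 1 - l' by rewrite subr_gt0.
  have [K [C [K0 C0 hKC]]] :=
    inertial_energy_bound a l (1 - l') (2 * M) ha hl c0 (mulr_ge0 (ler0n _ 2) M0).
  pose S k := alpha k * `|d k.+1| ^+ 2 + alpha k.+1 * `|d k.+2| ^+ 2
    + (`|e k| + `|e k.+1|).
  have hS : sums_bounded (fun k => C * S k).
    apply: sums_boundedZ => //; apply: sums_boundedD; apply: sums_boundedD => //.
      by apply: (sums_boundedS (fun k => alpha k * `|d k.+1| ^+ 2)); rewrite ?mulr_ge0 ?sqr_ge0.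
    exact: (sums_boundedS (fun k => `|e k|)).
  (* The energy bound retains half of [A k], so this potential drops by at least [A k / 2], up to
     summable terms. *)
  apply: (sums_bounded_telescope _ (fun k => A k + K * `|T (z k) - z k| ^+ 2)
    _ (1 / 2) _ _ hS) => [|k|k].
  - by rewrite divr_gt0.
  - by rewrite addr_ge0// mulr_ge0// sqr_ge0.
  have lk1 j : l <= lambda j < 1 by rewrite ll lam1.
  have := increment_le hip hT a (alpha k) (alpha k.+1) (lambda k) (lambda k.+1) l
    _ _ _ _ _ _ (al0 k) (halpha k.+1) hl (lk1 k) (lk1 k.+1) (zE k) (zE k.+1).
  have := residual_decrease hip hT (alpha k) (lambda k) l l'
    _ _ _ _ (al0 k) hl (hlambda k) hl' (zE k).
  move=> hL hG.
  have y0 : 0 <= `|d k.+1| <= 2 * M by rewrite normr_ge0 dD.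
  have := hKC `|d k| `|d k.+1| `|d k.+2| _ `|e k| `|e k.+1| _ (alpha k) (alpha k.+1)
    (normr_ge0 _) y0 (normr_ge0 _) (normr_ge0 _) (normr_ge0 _) (normr_ge0 _)
    (halpha k) (halpha k.+1) hG hL.
  by rewrite /A /S; lra.
have fejer x : T x = x ->
    cvgn (fun k => `|z k - x| ^+ 2) /\ sums_bounded (fun k => `|T (mu k) - mu k| ^+ 2).
  move=> Tx.
  (* The difference has no fixed sign; its positive part allows [alpha k] to be replaced by [a]. *)
  pose P k := Num.max (`|z k - x| ^+ 2 - `|zprev zm1 z k - x| ^+ 2) 0.
  have P0 k : 0 <= P k by rewrite /P le_max lexx orbT.
  pose B := M + `|x|.
  have B0 : 0 <= B by rewrite addr_ge0.
  pose dl k := 2 * A k + 2 * B * (lambda k * `|e k|).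
  have dl0 k : 0 <= dl k by rewrite addr_ge0// !mulr_ge0// ltW.
  have hdl : sums_bounded dl.
    by apply: sums_boundedD; apply: sums_boundedZ => //; rewrite mulr_ge0.
  have step k : l * (1 - l') * `|T (mu k) - mu k| ^+ 2 <=
      `|z k - x| ^+ 2 - `|z k.+1 - x| ^+ 2 + (a * P k + dl k).
    have alk : 0 <= alpha k <= 1 by rewrite al0 (le_trans (ala k))// ltW.
    have lamk : 0 <= lambda k <= 1 by rewrite !ltW.
    have := fejer_inertial hip hT _ _ _ _ _ _ _ _ Tx alk lamk (hmu k) (hz k).
    have h1 : alpha k * (`|z k - x| ^+ 2 - `|zprev zm1 z k - x| ^+ 2) <= a * P k.
      apply: (@le_trans _ _ (alpha k * P k)).
        by rewrite ler_wpM2l// /P le_max lexx.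
      by rewrite ler_wpM2r.
    have h2 : `|z k.+1 - x| * (lambda k * `|e k|) <= B * (lambda k * `|e k|).
      rewrite ler_wpM2r ?mulr_ge0 ?(ltW (lam0 k))//.
      rewrite (le_trans (ler_normB _ _))//.
      by rewrite lerD2r.
    have h3 : l * (1 - l') * `|T (mu k) - mu k| ^+ 2
        <= lambda k * (1 - lambda k) * `|T (mu k) - mu k| ^+ 2.
      rewrite ler_wpM2r ?sqr_ge0// ler_pM//; first exact: ltW.
        by rewrite subr_ge0 ltW.
      by rewrite lerB.
    by rewrite /dl /A /d; lra.
  have c0 : 0 < l * (1 - l') by rewrite mulr_gt0// subr_gt0.
  have step' k : `|z k.+1 - x| ^+ 2 <= `|z k - x| ^+ 2 + (a * P k + dl k).
    by have := step k; have := mulr_ge0 (ltW c0) (sqr_ge0 `|T (mu k) - mu k|) => ? ?; lra.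
  (* [P k.+1 <= a * P k + dl k] with [a < 1], so [P] serves as its own potential. *)
  have hP : sums_bounded P.
    apply: (sums_bounded_telescope _ P _ (1 - a) _ _ hdl) => // [|k].
      by rewrite subr_gt0.
    have : P k.+1 <= a * P k + dl k.
      rewrite {1}/P ge_max/= addr_ge0// ?mulr_ge0// andbT.
      by have := step' k => ?; lra.
    by lra.
  have hp : sums_bounded (fun k => a * P k + dl k).
    by apply: sums_boundedD => //; exact: sums_boundedZ.
  split.
    apply: (quasi_nonincreasing_cvg _ _ _ _ hp) => // k.
    by rewrite addr_ge0// mulr_ge0.
  apply: (sums_bounded_telescope _ (fun k => `|z k - x| ^+ 2) _ _ c0 _ hp) => //.
have hlim x : T x = x -> exists L : R, (fun k => `|z k - x|) @ \oo --> L.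
  move=> /fejer[/cvg_ex[L hL] _]; exists (Num.sqrt L).
  under eq_fun do rewrite -normr_id.
  apply: cvg_norm_sqrt.
  by under eq_fun do rewrite normr_id.
have hs : (fun k => `|T (mu k) - mu k|) @ \oo --> (0 : R).
  have [x /fejer[_ /sums_bounded_cvg0 h]] := hFix.
  under eq_fun do rewrite -normr_id.
  rewrite -sqrtr0; apply: cvg_norm_sqrt.
  under eq_fun do rewrite normr_id.
  by apply: h => k; exact: sqr_ge0.
split => //; split => //.
apply: (weak_cvg_fixed_point hip hT hM _ hlim).
(* The residual moves from [mu k] to [z k] at a cost of [2 * |mu k - z k| = 2 * alpha k * |d k|], at
   most [2 * Num.sqrt (A k)] because [alpha k <= 1]. *)
have hsA : (fun k => Num.sqrt (A k)) @ \oo --> (0 : R).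
  rewrite -sqrtr0; apply: continuous_cvg; first exact: sqrt_continuous.
  exact: sums_bounded_cvg0.
have hr0 : (fun k => `|T (mu k) - mu k| + 2 * Num.sqrt (A k)) @ \oo --> (0 : R).
  rewrite -[0]addr0 -[X in _ + X](mulr0 2).
  by apply: cvgD => //; apply: cvgM => //; exact: cvg_cst.
apply: (squeeze_cvgr _ (cvg_cst 0) hr0); apply: nearW => k.
rewrite normr_ge0/=.
have E : mu k - z k = alpha k *: d k by rewrite hmu addrAC subrr add0r.
have := nonexpansive_residual_le hT (z k) (mu k).
rewrite distrC [`|z k - _|]distrC E normrZ (ger0_norm (al0 k)) => h.
have hA1 : alpha k * `|d k| <= Num.sqrt (A k).
  rewrite -[leLHS]ger0_norm ?mulr_ge0// -sqrtr_sqr ler_wsqrtr// exprMn /A.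
  by rewrite [alpha k ^+ 2]expr2 -mulrA ler_piMl ?mulr_ge0 ?sqr_ge0// (le_trans (ala k))// ltW.
have := ler_normB (T (mu k) - mu k) (T (mu k) - mu k - (T (z k) - z k)).
by rewrite opprB addrCA subrr addr0; lra.
Qed.
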